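(* Let $X$ be a real Banach space. If the (closed) unit ball of $X$ is covered by a countable collection of planks in $X$, then the sum of the half-widths of these planks is at least $1$.
   Context: A plank in a real normed space $X$ is a set of the form $\{x\in X : |\phi(x)-m|\le w\}$, where $\phi\in X^*$ is a continuous linear functional of norm $1$, $m$ is a real number and $w$ is a positive real number; the number $w$ is called the half-width of the plank. The sum of half-widths is taken in $[0,\infty]$. Countable means finite or countably infinite. $X$ may be infinite-dimensional. *)

(* Defs.v *)
From HB Require Import structures.
From mathcomp Require Import all_boot all_order all_algebra.
From mathcomp Require Import all_classical all_reals all_analysis.
Set Implicit Arguments.
Unset Strict Implicit.
Unset Printing Implicit Defensive.
Import Order.TTheory GRing.Theory Num.Theory.
Import numFieldNormedType.Exports.
Local Open Scope classical_set_scope.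
Local Open Scope ring_scope.

(* The dual norm sup { |phi x| : |x| <= 1 }, valued in [0, +oo] so that it is
   meaningful for every linear form, continuous or not. *)
Definition dual_norm (R : realType) (X : normedModType R)
    (phi : {linear X -> R^o}) : \bar R :=
  ereal_sup [set `|(phi x : R)|%:E | x in closed_ball (0 : X) 1].

Definition is_plank (R : realType) (X : normedModType R)
    (A : set X) (w : R) : Prop :=
  0 < w /\
  exists (phi : {linear X -> R^o}) (m : R),
    [/\ continuous phi,
        dual_norm phi = 1%E &
        A = [set x : X | `|(phi x : R) - m| <= w]].

(* Main.v *)
Require Import Defs.
From HB Require Import structures.
From mathcomp Require Import all_boot all_order all_algebra.
From mathcomp Require Import all_classical all_reals all_analysis.
From mathcomp Require Import ring lra.
Set Implicit Arguments.
Unset Strict Implicit.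
Unset Printing Implicit Defensive.
Import Order.TTheory GRing.Theory Num.Theory.
Import numFieldNormedType.Exports.
Local Open Scope classical_set_scope.
Local Open Scope ring_scope.

(** This is Ball's theorem for planks in a Banach space.  Suppose that the
    half-widths sum to less than 1; the aim is a point of the unit ball outside
    every plank.

    Choose [y_j] with [phi_j y_j = 1] and norm close to 1, and look for the
    point as a combination of the [y_j] whose coefficients have absolute sum
    less than 1.  For finitely many planks this is a question about the matrix
    [A i j = phi_i (y_j)], whose diagonal entries are 1: find coefficients
    for which every [(A lambda) i] is at distance at least [w i] from [m i]
    ([matrix_plank]).  When a matrix [H] is symmetric, Bang's sign argument
    answers it: a choice of signs that maximizes a quadratic expression cannot
    be improved by a single flip ([bang_signs]).

    A general [A] is made symmetric as follows.  Put [B i j = A i j * sqrt (w j)]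
    and let [U] maximize [sum_i w i * ln ((B U) i i)] over the matrices of
    operator norm at most 1.  With [theta i = w i / (B U) i i] and
    [M = diag theta * B], the matrix [U] maximizes the linear form
    [V |-> tr (M V)] over the same set ([exists_log_optimal_contraction]).
    First variations of this maximum show that [H = M U] is symmetric
    ([optimal_mul_sym]), and that [(M i i)^2 / H i i <= (U M) i i]
    ([optimal_sqr_diag_le]).  By construction [H i i = w i], so summing the
    inequality gives [sum_i theta i ^ 2 <= sum_i w i].  Bang's lemma, applied to
    [H] with magnitudes [theta], gives a vector [v], and the coefficients are
    [lambda j = sqrt (w j) * (U v) j].

    These coefficients are [sqrt (w j)] times the entries of a vector of bounded
    Euclidean norm, so their tails are small uniformly in the number of planks.
    This is what makes the passage to infinitely many planks possible without
    any reflexivity: along an ultrafilter each coefficient converges, the uniform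
    tails make the finite-stage points Cauchy, and completeness gives the limit
    ([sequence_plank]). *)

(** * Bang's choice of signs *)

(** Let [q v = v^T H v - 2 p^T v] and let [v] maximize [q] among the vectors
    with entries [+- t i].  Flipping the sign of [v i] changes [q] by
    [4 (v i ^ 2 * H i i - v i * ((H v) i - p i))], which is therefore not
    positive. *)
Lemma bang_signs (R : realFieldType) (n : nat) (H : 'M[R]_n) (p t : 'I_n -> R) :
  H^T = H -> (forall i, 0 < t i) ->
  exists v : 'cV[R]_n, (forall i, v i 0 ^+ 2 = t i ^+ 2) /\
    forall i, H i i * t i <= `|(H *m v) i 0 - p i|.
Proof.
move=> Hsym t_gt0.
pose vec (e : {ffun 'I_n -> bool}) : 'cV[R]_n := \col_i ((-1) ^+ e i * t i).
pose q (v : 'cV[R]_n) := \sum_i v i 0 * ((H *m v) i 0 - 2 * p i).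
pose e0 : {ffun 'I_n -> bool} := [ffun=> false].
case: (@arg_maxP _ R _ e0 xpredT (fun e => q (vec e)) isT) => e _ emax.
exists (vec e); split=> [i|i]; first by rewrite mxE exprMn sqrr_sign mul1r.
set v := vec e.
pose e' : {ffun 'I_n -> bool} := [ffun j => (j == i) (+) e j].
have e'E : vec e' = v - (2 * v i 0) *: delta_mx i 0.
  apply/colP => j; rewrite !mxE ffunE; case: (altP (j =P i)) => [->|ji] /=.
    by rewrite signrN; ring.
  by rewrite mulr0 subr0.
have := emax e' isT; rewrite e'E /=.
have qE (c : R) : q (v - c *: delta_mx i 0) =
    q v - 2 * c * ((H *m v) i 0 - p i) + c ^+ 2 * H i i.
  have HvE j : (H *m (v - c *: delta_mx i 0)) j 0 = (H *m v) j 0 - c * H j i.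
    by rewrite mulmxBr -scalemxAr -colE !mxE.
  rewrite /q.
  under eq_bigr => j _.
    rewrite HvE [X in X * _](_ : _ = v j 0 - c * (j == i)%:R); last first.
      by rewrite !mxE eqxx andbT.
    rewrite (_ : _ * _ = v j 0 * ((H *m v) j 0 - 2 * p j) - c * (H j i * v j 0)
       - (if j == i then c * ((H *m v) j 0 - 2 * p j - c * H j i) else 0)); last first.
      by case: (j == i) => /=; ring.
    over.
  rewrite !sumrB -mulr_sumr -big_mkcond big_pred1_eq.
  have -> : \sum_j H j i * v j 0 = (H *m v) i 0.
    rewrite [RHS]mxE; apply: eq_bigr => j _.
    by rewrite -[in RHS]Hsym [H^T i j]mxE.
  by rewrite /q; ring.
rewrite qE => le_q.
have vt : v i 0 ^+ 2 = t i ^+ 2 by rewrite mxE exprMn sqrr_sign mul1r.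
have nv : `|v i 0| = t i.
  by rewrite mxE normrM normr_sign mul1r gtr0_norm.
have key : H i i * t i ^+ 2 <= v i 0 * ((H *m v) i 0 - p i).
  rewrite -vt; move: le_q; set x := (X in X - p i); set a := v i 0; set r := q v.
  by move=> ?; nra.
have := le_trans key (ler_norm _); rewrite normrM nv expr2 mulrA mulrC.
by rewrite ler_pM2l.
Qed.

(** * Contractions and the first variation of a trace *)

Definition sqnorm (R : realFieldType) n (x : 'cV[R]_n) : R :=
  \sum_i x i 0 ^+ 2.

Definition contraction (R : realFieldType) n (U : 'M[R]_n) : Prop :=
  forall x : 'cV[R]_n, sqnorm (U *m x) <= sqnorm x.

Lemma sqnormZ (R : realFieldType) n (c : R) (x : 'cV[R]_n) :
  sqnorm (c *: x) = c ^+ 2 * sqnorm x.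
Proof. by rewrite mulr_sumr; apply: eq_bigr => i _; rewrite !mxE exprMn. Qed.

Lemma sqnorm_ge0 (R : realFieldType) n (x : 'cV[R]_n) : 0 <= sqnorm x.
Proof. by apply: sumr_ge0 => i _; exact: sqr_ge0. Qed.

Lemma sqr_entry_le (R : realFieldType) n (x : 'cV[R]_n) i :
  x i 0 ^+ 2 <= sqnorm x.
Proof.
by rewrite /sqnorm (bigD1 i)//= lerDl sumr_ge0// => j _; exact: sqr_ge0.
Qed.

Lemma sqnorm_delta (R : realFieldType) n (i : 'I_n) :
  sqnorm (delta_mx i 0 : 'cV[R]_n) = 1.
Proof.
rewrite /sqnorm (bigD1 i)//= big1 ?addr0 => [|j ji].
  by rewrite mxE !eqxx expr1n.
by rewrite mxE (negbTE ji) expr0n.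
Qed.

Lemma sqnormD_delta (R : realFieldType) n (x : 'cV[R]_n) (c : R) i :
  sqnorm (x + c *: delta_mx i 0) = sqnorm x + 2 * c * x i 0 + c ^+ 2.
Proof.
rewrite /sqnorm (bigD1 i)//= [in RHS](bigD1 i)//= !mxE !eqxx/=.
rewrite [X in _ + X = _](eq_bigr (fun j => x j 0 ^+ 2)) => [|j ji]; first by ring.
by rewrite !mxE (negbTE ji) mulr0 addr0.
Qed.

Lemma mxtrace_mul_delta (R : comNzRingType) n (A : 'M[R]_n) i j :
  \tr (A *m delta_mx i j) = A j i.
Proof.
rewrite /mxtrace (bigD1 j)//= big1 ?addr0 => [|k kj]; rewrite mxE.
  rewrite (bigD1 i)//= big1 ?addr0 => [|l li]; rewrite mxE ?eqxx ?mulr1//.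
  by rewrite (negbTE li) mulr0.
by rewrite big1// => l _; rewrite mxE (negbTE kj) andbF mulr0.
Qed.

Lemma delta_mx_mul_col (R : pzSemiRingType) n (x : 'cV[R]_n) (i j : 'I_n) :
  delta_mx i j *m x = x j 0 *: delta_mx i 0.
Proof.
apply/colP => k; rewrite !mxE (bigD1 j)//= big1 ?addr0 => [|l lj]; rewrite mxE.
  by rewrite !eqxx; case: (k == i); rewrite /= ?(mul1r, mul0r, mulr1, mulr0).
by rewrite (negbTE lj) andbF mul0r.
Qed.

(** The perturbation [U - s Y] exceeds norm 1 only to second order in [s], so
    after normalization it competes with [U]: the first-order change
    [- s * tr (M Y)] of the trace cannot be positive. *)
Lemma trace_first_order (R : rcfType) n (M U Y : 'M[R]_n) (C : R) :
  (forall V, contraction V -> \tr (M *m V) <= \tr (M *m U)) ->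
  0 <= C ->
  (forall (s : R) (x : 'cV[R]_n), 0 < s ->
     sqnorm ((U - s *: Y) *m x) <= (1 + C * s ^+ 2) * sqnorm x) ->
  0 <= \tr (M *m Y).
Proof.
move=> Umax C_ge0 hY.
have T_ge0 : 0 <= \tr (M *m U).
  rewrite -[leLHS](@mxtrace0 R n) -(mulmx0 _ M) Umax// => x.
  by rewrite mul0mx -(scale0r 0) sqnormZ expr0n mul0r sqnorm_ge0.
set T := \tr (M *m U) in T_ge0 *.
have le_s s : 0 < s -> - \tr (M *m Y) <= C * T * s.
  move=> s_gt0; set r := Num.sqrt (1 + C * s ^+ 2).
  have k_ge1 : 1 <= 1 + C * s ^+ 2 by rewrite lerDl mulr_ge0// sqr_ge0.
  have r2 : r ^+ 2 = 1 + C * s ^+ 2 by rewrite sqr_sqrtr// (le_trans _ k_ge1).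
  have r_ge1 : 1 <= r by rewrite -(sqrtr1 R) ler_wsqrtr.
  have r_gt0 : 0 < r by exact: lt_le_trans r_ge1.
  have /Umax : contraction (r^-1 *: (U - s *: Y)).
    move=> x; rewrite -scalemxAl sqnormZ exprVn ler_pdivrMl ?exprn_gt0//.
    by rewrite r2 hY.
  rewrite -scalemxAr mxtraceZ ler_pdivrMl// mulmxBr -scalemxAr mxtraceD.
  rewrite -scaleN1r !mxtraceZ -/T mulN1r => le1.
  have : r * T <= (1 + C * s ^+ 2) * T.
    by rewrite ler_wpM2r// -r2 expr2 ler_peMl// ltW.
  move=> le2; rewrite -(ler_pM2l s_gt0); move: le1 le2.
  by set y := \tr _; move=> *; nra.
rewrite leNgt; apply/negP => y_lt0.
set y := \tr _ in y_lt0 le_s.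
have CT_ge0 : 0 <= C * T by exact: mulr_ge0.
have := le_s (- y / (1 + C * T) / 2) _.
have d_gt0 : 0 < 1 + C * T by rewrite ltr_wpDr.
have -> : 0 < - y / (1 + C * T) / 2 by rewrite !divr_gt0// oppr_gt0.
move=> /(_ isT); set d := 1 + C * T in d_gt0 *.
have -> : C * T = d - 1 by rewrite /d; ring.
rewrite -(ler_pM2l d_gt0).
rewrite (_ : d * ((d - 1) * (- y / d / 2)) = (d - 1) * (- y) / 2); last first.
  by field; rewrite gt_eqF.
have : 1 <= d by rewrite lerDl.
by move: y_lt0; clear; move=> *; nra.
Qed.

(** Perturb [U] by [U S] with [S] an elementary antisymmetric matrix: [1 - s S] is
    a rotation up to second order, and [tr (M U S)] is a difference of two
    opposite off-diagonal entries of [M U]. *)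
Lemma optimal_mul_sym (R : rcfType) n (M U : 'M[R]_n) :
  contraction U ->
  (forall V, contraction V -> \tr (M *m V) <= \tr (M *m U)) ->
  (M *m U)^T = M *m U.
Proof.
move=> Uc Umax.
suff le_ij i j : i != j -> (M *m U) i j <= (M *m U) j i.
  apply/matrixP => i j; rewrite mxE.
  have [->//|ij] := eqVneq i j.
  by apply/eqP; rewrite eq_le !le_ij// eq_sym.
move=> ij.
rewrite -subr_ge0 -!mxtrace_mul_delta -linearB -mulmxBr -mulmxA.
apply: (@trace_first_order R n M U _ 2) => // s x s_gt0.
set S := delta_mx i j - delta_mx j i.
rewrite (_ : U - _ = U *m (1%:M - s *: S)); last first.
  by rewrite [RHS]mulmxBr mulmx1 -scalemxAr mulmxBr.
rewrite -mulmxA; apply: le_trans (Uc _) _.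
rewrite mulmxBl mul1mx -scalemxAl mulmxBl !delta_mx_mul_col.
rewrite (_ : x - _ = x + (- s * x j 0) *: delta_mx i 0
                       + (s * x i 0) *: delta_mx j 0); last first.
  by rewrite scalerBr !scalerA opprB mulNr scaleNr addrA addrAC.
rewrite !sqnormD_delta !mxE (eq_sym j i) (negbTE ij) mulr0 addr0.
have := sqr_entry_le x i; have := sqr_entry_le x j.
set N := sqnorm x => hj hi.
rewrite (_ : _ + _ = N + s ^+ 2 * (x i 0 ^+ 2 + x j 0 ^+ 2)); last by ring.
rewrite mulrDl mul1r lerD2l -subr_ge0.
rewrite (_ : _ - _ = s ^+ 2 * ((N - x i 0 ^+ 2) + (N - x j 0 ^+ 2))); last by ring.
by rewrite mulr_ge0 ?sqr_ge0// addr_ge0// subr_ge0.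
Qed.

(** If [U] is orthogonal, then [M U] is positive semidefinite and the inequality
    is Cauchy-Schwarz for [M = (M U) U^T] on the vectors [e_i] and [U^T e_i].
    The single perturbation used below gives it directly for every
    contraction, without extracting a polar decomposition of [M]. *)
Lemma optimal_sqr_diag_le (R : rcfType) n (M U : 'M[R]_n) i :
  contraction U ->
  (forall V, contraction V -> \tr (M *m V) <= \tr (M *m U)) ->
  0 < (M *m U) i i ->
  M i i ^+ 2 / (M *m U) i i <= (U *m M) i i.
Proof.
move=> Uc Umax h_gt0.
(* A nonnegative quadratic polynomial in [a]; its value at
   [M i i / (M U) i i] is the claim. *)
suff quad a : 0 <= a ^+ 2 * (M *m U) i i - 2 * a * M i i + (U *m M) i i.
  have := quad (M i i / (M *m U) i i); set h := (M *m U) i i in h_gt0 *.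
  move=> q_ge0; rewrite -subr_ge0; apply: le_trans q_ge0 _; rewrite le_eqVlt; apply/orP; left; apply/eqP.
  by field; rewrite gt_eqF.
pose P : 'M[R]_n := delta_mx i i.
have -> : a ^+ 2 * (M *m U) i i - 2 * a * M i i + (U *m M) i i =
    \tr (M *m (a ^+ 2 *: (U *m P) - (2 * a) *: P + P *m U)).
  rewrite mulmxDr mulmxBr -!scalemxAr !mulmxA linearD linearB !linearZ /=.
  by rewrite [\tr (_ *m P *m U)]mxtrace_mulC mulmxA !mxtrace_mul_delta.
(* The squared norm of the perturbed image of [x] is at most
   [sqnorm x - 2 s (a * x i - (U x) i)^2] plus terms of second order in [s],
   which [C] bounds. *)
pose C := 2 * a ^+ 4 + 16 * a ^+ 2 + 4.
apply: (@trace_first_order R n M U _ C) => //.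
  by rewrite /C; have := sqr_ge0 (a ^+ 2); have := sqr_ge0 a; nra.
move=> s x s_gt0.
pose c := 2 * a * x i 0 - (U *m x) i 0.
rewrite (_ : _ *m x = U *m (x + (- s * a ^+ 2 * x i 0) *: delta_mx i 0)
                      + (s * c) *: delta_mx i 0); last first.
  rewrite mulmxBl -scalemxAl !mulmxDl mulNmx -!scalemxAl -!mulmxA.
  rewrite !delta_mx_mul_col mulmxDr -!scalemxAr /c.
  apply/colP => k; rewrite !mxE; ring.
have := Uc (x + (- s * a ^+ 2 * x i 0) *: delta_mx i 0).
rewrite !sqnormD_delta.
rewrite mulmxDr -scalemxAr -colE; set z := sqnorm (_ + _).
have -> : (U *m x + (- s * a ^+ 2 * x i 0) *: col i U) i 0 =
    (U *m x) i 0 + (- s * a ^+ 2 * x i 0) * U i i.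
  by rewrite [LHS]mxE; congr (_ + _); rewrite !mxE.
have := sqr_entry_le x i; have := le_trans (sqr_entry_le (U *m x) i) (Uc x).
have : U i i ^+ 2 <= 1.
  rewrite -(sqnorm_delta R i); apply: le_trans (Uc _).
  by have := sqr_entry_le (U *m delta_mx i 0) i; rewrite -colE mxE.
rewrite /C /c; set b := (U *m x) i 0; set N := sqnorm x; set y := x i 0.
set u := U i i; move: z b N y u; clear -s_gt0 => z b N y u hu hb hy hz.
set d := 2 * a * y - b; set k := a ^+ 2 * y.
have k2 : k ^+ 2 <= a ^+ 4 * N.
  by rewrite /k exprMn -exprM ler_wpM2l// exprn_even_ge0.
have d2 : d ^+ 2 <= (8 * a ^+ 2 + 2) * N.
  have : a ^+ 2 * y ^+ 2 <= a ^+ 2 * N by rewrite ler_wpM2l// sqr_ge0.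
  by have := sqr_ge0 (2 * a * y + b); rewrite /d; nra.
have duk : - (d ^+ 2 + k ^+ 2) <= 2 * (d * k * u).
  have : k ^+ 2 * u ^+ 2 <= k ^+ 2 * 1 by rewrite ler_wpM2l// sqr_ge0.
  by have := sqr_ge0 (d + k * u); nra.
have hs : 0 <= s ^+ 2 * ((2 * a ^+ 4 + 16 * a ^+ 2 + 4) * N - k ^+ 2 - d ^+ 2
                        + 2 * (d * k * u)).
  apply: mulr_ge0; [exact: sqr_ge0|lra].
have hq : 0 <= s * (2 * (a * y - b) ^+ 2).
  apply: mulr_ge0; [exact: ltW|apply: mulr_ge0; [by []|exact: sqr_ge0]].
rewrite -subr_ge0 in hz; rewrite -subr_ge0.
apply: le_trans (addr_ge0 (addr_ge0 hs hq) hz) _.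
by rewrite le_eqVlt; apply/orP; left; apply/eqP; rewrite /d /k; ring.
Qed.

(** * Compactness of the set of contractions *)

Lemma cvg_sumr (R : realType) (T : Type) (F : set_system T) (FF : Filter F)
    (I : Type) (r : seq I) (f : I -> T -> R) (l : I -> R) :
  (forall i, f i x @[x --> F] --> l i) ->
  \sum_(i <- r) f i x @[x --> F] --> \sum_(i <- r) l i.
Proof.
by move=> fl; apply: (cvg_big (op := +%R)) => // ; exact: add_continuous.
Qed.

Lemma contraction1 (R : realFieldType) n : contraction (1%:M : 'M[R]_n).
Proof. by move=> x; rewrite mul1mx. Qed.

Lemma contraction_entry_le1 (R : realFieldType) n (U : 'M[R]_n) i j :
  contraction U -> `|U i j| <= 1.
Proof.
move=> Uc; rewrite -(@ler_pXn2r _ 2)// ?nnegrE// real_normK ?num_real// expr1n.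
rewrite -(sqnorm_delta R j); apply: le_trans (Uc _).
by have := sqr_entry_le (U *m delta_mx j 0) i; rewrite -colE mxE.
Qed.

Lemma contraction_convex (R : realFieldType) n (U V : 'M[R]_n) (t : R) :
  0 <= t <= 1 -> contraction U -> contraction V ->
  contraction (U + t *: (V - U)).
Proof.
move=> /andP[t_ge0 t_le1] Uc Vc x.
have le1 : (1 - t) * sqnorm (U *m x) + t * sqnorm (V *m x) <= sqnorm x.
  have := Uc x; have := Vc x; set u := sqnorm (U *m x); set v := sqnorm (V *m x).
  by move=> *; nra.
apply: le_trans le1; rewrite /sqnorm !mulr_sumr -big_split /=.
apply: ler_sum => i _; rewrite mulmxDl -scalemxAl mulmxBl !mxE.
set u := \sum_j U i j * _; set v := \sum_j V i j * _.
have := mulr_ge0 (mulr_ge0 t_ge0 (_ : 0 <= 1 - t)) (sqr_ge0 (u - v)).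
rewrite subr_ge0 => /(_ t_le1) h; rewrite -subr_ge0; apply: le_trans h _.
by rewrite le_eqVlt; apply/orP; left; apply/eqP; ring.
Qed.

Lemma continuous_mulmx_entry (R : realType) m n p q
    (A : 'M[R]_(m, n)) (C : 'M[R]_(p, q)) i j :
  continuous (fun u : 'rV[R]_(n * p) => (A *m vec_mx u *m C) i j).
Proof.
move=> u; rewrite /continuous_at mxE.
under eq_fun do rewrite mxE.
apply: (@cvg_sumr R _ (nbhs u)) => k.
apply: cvgMr_tmp; rewrite mxE.
under eq_fun do rewrite mxE.
apply: (@cvg_sumr R _ (nbhs u)) => l; apply: cvgMl_tmp; rewrite mxE.
under eq_fun do rewrite mxE.
exact: coord_continuous.
Qed.

(** The constraint on the diagonal of [B V] keeps the maximization of
    logarithms below in the region where they are continuous.  Matrices are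
    represented by row vectors, for which the Heine-Borel theorem is stated. *)
Lemma compact_contraction (R : realType) n (B : 'M[R]_n) (d : R) :
  compact [set u : 'rV[R]_(n * n) | contraction (vec_mx u) /\
                            forall i, d <= (B *m vec_mx u) i i].
Proof.
have box : compact [set u : 'rV[R]_(n * n) | forall k, `[-1, 1]%classic (u ord0 k)].
  by apply: (@rV_compact R _ (fun=> `[(-1)%R, 1%R]%classic)) => _; exact: segment_compact.
apply: subclosed_compact box _; last first.
  move=> u [uc _] k /=; rewrite in_itv /= -ler_norml.
  case/mxvec_indexP: k => i j.
  by have := contraction_entry_le1 i j uc; rewrite mxE.
rewrite (_ : mkset _ =
    (\bigcap_(x in [set: 'cV[R]_n])
       (fun u => sqnorm (vec_mx u *m x)) @^-1` [set r | r <= sqnorm x]) `&`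
    (\bigcap_(i in [set: 'I_n])
       (fun u => (B *m vec_mx u) i i) @^-1` [set r | d <= r])); last first.
  apply/seteqP; split=> u [h1 h2]; split.
  - by move=> x _; exact: h1.
  - by move=> i _; exact: h2.
  - by move=> x; exact: h1.
  - by move=> i; exact: h2.
apply: closedI; apply: closed_bigI => z _.
  apply: preimage_closed; last exact: closed_le.
  move=> u _; apply: (@cvg_sumr R _ (nbhs u)) => i.
  have c : (vec_mx v *m z) i 0 @[v --> u] --> (vec_mx u *m z) i 0.
    have := @continuous_mulmx_entry R n n n 1 1%:M z i 0 u.
    rewrite /continuous_at mul1mx.
    by under eq_fun do rewrite mul1mx.
  under eq_fun do rewrite expr2.
  by rewrite expr2; exact: cvgM.
apply: preimage_closed; last exact: closed_ge.
move=> u _; have := @continuous_mulmx_entry R n n n n B 1%:M z z u.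
rewrite /continuous_at mulmx1.
by under eq_fun do rewrite mulmx1.
Qed.

(** * Maximizing the weighted logarithms *)

Lemma ln_shift_ge (R : realType) (a h : R) :
  0 < a -> `|h| <= a / 2 -> ln a + h / a - 2 * (h / a) ^+ 2 <= ln (a + h).
Proof.
move=> a_gt0 ha; have {ha} : - (a / 2) <= h <= a / 2 by rewrite -ler_norml.
move=> /andP[h1 h2].
have s_gt0 : 0 < a + h by lra.
have q_gt0 : 0 < a / (a + h) by rewrite divr_gt0.
have := @le_ln1Dx R (a / (a + h) - 1).
rewrite ltrBrDl subrr q_gt0 => /(_ isT).
rewrite (_ : 1 + (a / (a + h) - 1) = a / (a + h)); last by ring.
rewrite ln_div ?posrE// => le1.
have le2 : a / (a + h) - 1 <= - (h / a) + 2 * (h / a) ^+ 2.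
  rewrite -subr_ge0.
  rewrite (_ : _ - _ = (h / a) ^+ 2 * ((a + 2 * h) / (a + h))); last first.
    by field; rewrite !gt_eqF.
  by rewrite mulr_ge0 ?sqr_ge0// divr_ge0 ?(ltW s_gt0)//; lra.
lra.
Qed.

Section log_maximum.
Variables (R : realType) (n : nat) (B : 'M[R]_n) (w : 'I_n -> R).
Hypotheses (w_gt0 : forall i, 0 < w i) (B_gt0 : forall i, 0 < B i i).

Let obj (V : 'M[R]_n) : R := \sum_i w i * ln ((B *m V) i i).

Let diag_bounded : exists2 L : R, 1 <= L &
  forall V, contraction V -> forall i, (B *m V) i i <= L.
Proof.
exists (1 + \sum_i \sum_j `|B i j|) => [|V Vc i].
  by rewrite lerDl sumr_ge0// => i _; rewrite sumr_ge0.
rewrite (bigD1 i)//= [leRHS]addrCA -[leLHS]addr0 lerD//; last first.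
  by rewrite addr_ge0// sumr_ge0// => j _; rewrite sumr_ge0.
rewrite mxE; apply: ler_sum => j _; apply: le_trans (ler_norm _) _.
by rewrite normrM ler_piMr// contraction_entry_le1.
Qed.

(** All diagonal entries are bounded above, so one small entry makes the weighted
    sum of logarithms very negative: near the boundary a matrix does worse than
    the identity. *)
Let small_diag_not_max : exists2 d : R, 0 < d &
  forall V, contraction V -> (forall i, 0 < (B *m V) i i) ->
  forall i, (B *m V) i i < d -> obj V < obj 1%:M.
Proof.
have [L L_ge1 BL] := diag_bounded.
pose D := `|obj 1%:M - (\sum_i w i) * ln L|.
(* Summing [D / w i] over all indices gives one threshold that works for
   each [i]. *)
exists (expR (- (\sum_i D / w i) - 1)) => [|V Vc Vpos i Vi]; first exact: expR_gt0.
have lnV : ln ((B *m V) i i) < - (\sum_i D / w i) - 1.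
  by rewrite -ltr_expR lnK ?posrE.
have le1 : obj V <= w i * ln ((B *m V) i i) + (\sum_i w i) * ln L.
  rewrite /obj (bigD1 i)//= lerD2l mulr_suml [leRHS](bigD1 i)//=.
  rewrite -[leLHS]add0r lerD//; first by rewrite mulr_ge0 ?ln_ge0// ltW.
  apply: ler_sum => j _; rewrite ler_pM2l// ler_ln ?posrE ?BL//.
  exact: lt_le_trans L_ge1.
have le2 : w i * ln ((B *m V) i i) < - D.
  have h : D <= w i * \sum_i D / w i.
    rewrite (bigD1 i)//= mulrDr mulrCA divff ?gt_eqF// mulr1 lerDl.
    apply: mulr_ge0; [exact: ltW|apply: sumr_ge0 => j _].
    by apply: divr_ge0; [exact: normr_ge0|exact: ltW].
  rewrite -(ltr_pM2l (w_gt0 i)) in lnV; have := w_gt0 i.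
  by rewrite mulrBr mulrN mulr1 in lnV; lra.
have : - D <= obj 1%:M - (\sum_i w i) * ln L by rewrite /D lerNl -normrN ler_norm.
lra.
Qed.

Let log_maximizer : exists U, [/\ contraction U,
  forall i, 0 < (B *m U) i i &
  forall V, contraction V -> (forall i, 0 < (B *m V) i i) -> obj V <= obj U].
Proof.
have [d d_gt0 small] := small_diag_not_max.
pose K := [set u : 'rV[R]_(n * n) | contraction (vec_mx u) /\
                            forall i, d <= (B *m vec_mx u) i i].
have K1 : K (mxvec 1%:M).
  rewrite /K /= mxvecK; split=> [|i]; first exact: contraction1.
  rewrite leNgt; apply/negP => lt_d.
  have : obj 1%:M < obj 1%:M.
    by apply: small lt_d => [|j]; [exact: contraction1|rewrite mulmx1].
  by rewrite ltxx.
have objc : {within K, continuous (fun u => obj (vec_mx u))}.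
  apply: continuous_in_subspaceT => u /set_mem [_ uK].
  apply: (@cvg_sumr R _ (nbhs u)) => i; apply: cvgMl_tmp.
  have c : (B *m vec_mx v) i i @[v --> u] --> (B *m vec_mx u) i i.
    have := @continuous_mulmx_entry R n n n n B 1%:M i i u.
    rewrite /continuous_at mulmx1.
    by under eq_fun do rewrite mulmx1.
  by apply: continuous_cvg c; apply: continuous_ln; exact: lt_le_trans (uK i).
have [u /set_mem [uc uK] umax] :=
  EVT_max_rV (ex_intro _ _ K1) (@compact_contraction R n B d) objc.
exists (vec_mx u); split=> // [i|V Vc Vpos]; first exact: lt_le_trans (uK i).
have [KV|] := pselect (forall i, d <= (B *m V) i i).
  by have := umax (mxvec V); rewrite mxvecK; apply; rewrite inE /= mxvecK.
move=> /existsNP[i /negP]; rewrite -ltNge => Vi.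
apply: le_trans (ltW (small _ Vc Vpos i Vi)) _.
by have := umax (mxvec 1%:M); rewrite mxvecK; apply; rewrite inE.
Qed.

(** The objective is concave and contractions form a convex set, so the
    derivative at the maximum towards any other contraction [V] is at most 0.
    That derivative is the difference of the two sides. *)
Lemma exists_log_optimal_contraction : exists U, [/\ contraction U,
  forall i, 0 < (B *m U) i i &
  forall V, contraction V ->
    \sum_i w i * (B *m V) i i / (B *m U) i i <= \sum_i w i].
Proof.
have [U [Uc Upos Umax]] := log_maximizer.
exists U; split=> // V Vc.
pose a i := (B *m U) i i; pose e i := (B *m V) i i - a i.
have a_neq0 i : a i != 0 by rewrite gt_eqF// Upos.
rewrite -subr_le0 -sumrB (eq_bigr (fun i => w i * (e i / a i))); last first.
  by move=> i _; rewrite /e -/(a i); field.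
set S := \sum_i _; set Q := \sum_i w i * (e i / a i) ^+ 2.
pose t0 := (1 + 2 * \sum_i `|e i / a i|)^-1.
have E_ge0 : 0 <= \sum_i `|e i / a i| by rewrite sumr_ge0.
have t0_gt0 : 0 < t0 by rewrite invr_gt0 ltr_wpDr// mulr_ge0.
have t0_le1 : t0 <= 1 by rewrite invf_le1 ?lerDl ?mulr_ge0// ltr_wpDr// mulr_ge0.
(* [S] is the derivative in the direction of [V], and the second-order error
   of the logarithms is at most [2 t^2 Q]. *)
have S_le t : 0 < t <= t0 -> S <= 2 * t * Q.
  move=> /andP[t_gt0 t_le].
  have te i : `|t * e i| <= a i / 2.
    have h : `|e i / a i| <= \sum_i `|e i / a i|.
      by rewrite (bigD1 i)//= lerDl sumr_ge0.
    rewrite normrM (gtr0_norm t_gt0).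
    rewrite (_ : `|e i| = `|e i / a i| * a i); last first.
      by rewrite normrM normfV (gtr0_norm (Upos i : 0 < a i)) mulfVK.
    rewrite mulrA mulrC ler_pM2l//; last exact: Upos.
    have tE : t * (1 + 2 * \sum_i `|e i / a i|) <= 1.
      by rewrite -ler_pdivlMr ?div1r//; lra.
    have : t * `|e i / a i| <= t * \sum_i `|e i / a i| by rewrite ler_pM2l.
    lra.
  pose V' := U + t *: (V - U).
  have V'E i : (B *m V') i i = a i + t * e i.
    rewrite mulmxDr -scalemxAr mulmxBr /e /a [LHS]mxE; congr (_ + _).
    by rewrite !mxE.
  have V'pos i : 0 < (B *m V') i i.
    rewrite V'E; have := te i; rewrite ler_norml => /andP[h _].
    by have := Upos i; rewrite -/(a i); lra.
  have := Umax V' (contraction_convex _ Uc Vc) V'pos.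
  rewrite (ltW t_gt0) (le_trans t_le)// => /(_ isT) leU.
  have : obj U + t * S - 2 * t ^+ 2 * Q <= obj V'.
    rewrite /obj !mulr_sumr -big_split -sumrB /=; apply: ler_sum => i _.
    rewrite V'E; have h := ln_shift_ge (Upos i) (te i).
    rewrite -/(a i) -(ler_pM2l (w_gt0 i)) in h; apply: le_trans h.
    by rewrite le_eqVlt; apply/orP; left; apply/eqP; field.
  move=> /le_trans /(_ leU) h; rewrite -(ler_pM2l t_gt0); move: h; lra.
rewrite leNgt; apply/negP => S_gt0.
have Q_ge0 : 0 <= Q.
  by apply: sumr_ge0 => i _; rewrite mulr_ge0 ?sqr_ge0// ltW.
pose t := Num.min t0 (S / (4 * (1 + Q))).
have d_gt0 : 0 < 4 * (1 + Q) by lra.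
have t_gt0 : 0 < t by rewrite lt_min t0_gt0 divr_gt0.
have := S_le t; rewrite t_gt0 ge_min lexx => /(_ isT).
have : t * (4 * (1 + Q)) <= S by rewrite -ler_pdivlMr// ge_min lexx orbT.
nra.
Qed.

End log_maximum.

(** * Finitely many planks *)

(** The coefficients are [sqrt (w j) * mu j] with [mu] bounded in the Euclidean
    norm; this controls the absolute sum of the coefficients over any set of
    indices by the weights [w j] there. *)
Lemma matrix_plank (R : realType) n (A : 'M[R]_n) (w m : 'I_n -> R) :
  (forall i, A i i = 1) -> (forall i, 0 < w i) ->
  exists2 mu : 'cV[R]_n, sqnorm mu <= \sum_i w i &
    forall i, w i <= `|\sum_j A i j * (Num.sqrt (w j) * mu j 0) - m i|.
Proof.
move=> A1 w_gt0.
pose B : 'M[R]_n := \matrix_(i, j) (A i j * Num.sqrt (w j)).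
have B_gt0 i : 0 < B i i by rewrite mxE A1 mul1r sqrtr_gt0.
have [U [Uc Upos Uopt]] := exists_log_optimal_contraction w_gt0 B_gt0.
pose t i := w i / (B *m U) i i.
have t_gt0 i : 0 < t i by rewrite divr_gt0.
pose M := diag_mx (\row_i t i) *m B.
have trM V : \tr (M *m V) = \sum_i w i * (B *m V) i i / (B *m U) i i.
  rewrite /mxtrace; apply: eq_bigr => i _.
  by rewrite /M -mulmxA mul_diag_mx mxE [in X in X * _]mxE /t mulrAC.
have hE i : (M *m U) i i = w i.
  by rewrite /M -mulmxA mul_diag_mx mxE [in X in X * _]mxE /t divfK// gt_eqF.
have Umax V : contraction V -> \tr (M *m V) <= \tr (M *m U).
  by move=> /Uopt; rewrite trM /mxtrace (eq_bigr _ (fun i _ => hE i)).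
have sum_t2 : \sum_i t i ^+ 2 <= \sum_i w i.
  rewrite -(eq_bigr _ (fun i _ => hE i)) -[leRHS]/(\tr (M *m U)) mxtrace_mulC.
  apply: ler_sum => i _.
  have := optimal_sqr_diag_le (i := i) Uc Umax; rewrite hE => /(_ (w_gt0 i)) h.
  apply: le_trans h; rewrite le_eqVlt; apply/orP; left; apply/eqP.
  have -> : M i i = t i * Num.sqrt (w i) by rewrite /M mul_diag_mx !mxE A1 mul1r.
  rewrite [in RHS]exprMn.
  by rewrite sqr_sqrtr ?ltW// mulfK// gt_eqF.
have [v [v2 vH]] := bang_signs (fun i => t i * m i) (optimal_mul_sym Uc Umax) t_gt0.
exists (U *m v).
  apply: le_trans (Uc v) _; apply: le_trans sum_t2.
  by rewrite /sqnorm (eq_bigr _ (fun i _ => v2 i)).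
move=> i; have := vH i; rewrite hE.
have -> : (M *m U *m v) i 0 = t i * \sum_j A i j * (Num.sqrt (w j) * (U *m v) j 0).
  rewrite /M -!mulmxA mul_diag_mx mxE [in X in X * _]mxE [in LHS]mxE.
  by congr (_ * _); apply: eq_bigr => j _; rewrite [B i j]mxE mulrA.
by rewrite -mulrBr normrM gtr0_norm// mulrC ler_pM2l.
Qed.

(** * Countably many planks *)

Lemma ultra_bounded_cvg (R : realType) (T : Type) (G : set_system T)
    (GU : UltraFilter G) (f : T -> R) (M : R) :
  (forall t, `|f t| <= M) -> exists l : R, f t @[t --> G] --> l.
Proof.
move=> fM.
have fGP : ProperFilter (f @ G) by exact: fmap_proper_filter.
have fGI : (f @ G) `[- M, M]%classic.
  by apply: (@filterE _ G) => t; rewrite /preimage /= in_itv /= -ler_norml.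
have [l [_ fl]] := segment_compact fGP fGI.
exists l => V Vl.
have [//|GV] := in_ultra_setVsetC (f @^-1` V) GU.
by have [z []] := fl (~` V) V GV Vl.
Qed.

Lemma tail_sum_small (R : realType) (W : nat -> R) (c e : R) :
  (forall n, \sum_(k < n) W k <= c) -> 0 < e ->
  exists N, forall n, \sum_(k < n | (N <= k)%N) W k <= e.
Proof.
move=> Wc e_gt0.
pose P := range (fun n => \sum_(k < n) W k).
have supP : has_sup P.
  split; first by exists (\sum_(k < 0) W k), 0%N.
  by exists c => _ [n _ <-].
have [_ [N _ <-] ltN] := sup_adherent e_gt0 supP.
exists N => n.
have [nN|Nn] := leqP n N.
  rewrite big_pred0 ?ltW// => k; apply/negbTE; rewrite -ltnNge.
  exact: leq_trans nN.
have : \sum_(k < n) W k <= sup P by apply: sup_upper_bound => //; exists n.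
rewrite (bigID (fun k : 'I_n => N <= k)%N)/=.
rewrite [X in _ + X](eq_bigl (fun k : 'I_n => k < N)%N) => [|k]; last by rewrite ltnNge.
rewrite -(big_ord_widen n (fun k => W k) (ltnW Nn)).
lra.
Qed.

Section sequence.
Variables (R : realType) (X : normedModType R).
Variables (phi : nat -> {linear X -> R^o}) (y : nat -> X) (m W : nat -> R) (c : R).
Hypothesis phi_y : forall k, phi k (y k) = 1 :> R.
Hypothesis W_gt0 : forall k, 0 < W k.
Hypothesis W_sum : forall n, \sum_(k < n) W k <= c.

(** The second clause is the Euclidean bound on the coefficients, combined with
    [sqrt w * |mu| <= (w / r + r * mu^2) / 2].  With [r = 1] it bounds the whole
    absolute sum by [c]; with small [r] it makes tails small, uniformly in
    [n]. *)
Lemma finite_plank (n : nat) : exists l : nat -> R, [/\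
  forall j, (n <= j)%N -> l j = 0,
  forall r (P : pred 'I_n), 0 < r ->
    \sum_(j < n | P j) `|l j| <= ((\sum_(j < n | P j) W j) / r + r * c) / 2 &
  forall i, (i < n)%N ->
    W i <= `|(phi i (\sum_(j < n) l j *: y j) : R) - m i|].
Proof.
pose A : 'M[R]_n := \matrix_(i, j) (phi i (y j) : R).
have [i|i|mu mu_le mu_plank] := @matrix_plank R n A (fun i => W i) (fun i => m i).
- by rewrite mxE phi_y.
- exact: W_gt0.
pose l j : R := if insub j is Some i then Num.sqrt (W j) * mu i 0 else 0.
have lE (j : 'I_n) : l j = Num.sqrt (W j) * mu j 0 by rewrite /l valK.
exists l; split=> [j nj|r P r_gt0|i i_n].
- by rewrite /l insubF// ltnNge nj.
- have mu_c : \sum_(j < n | P j) mu j 0 ^+ 2 <= c.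
    apply: le_trans (W_sum n); apply: le_trans mu_le.
    rewrite /sqnorm [leRHS](bigID P)/= lerDl sumr_ge0// => j _; exact: sqr_ge0.
  apply: (@le_trans _ _ (((\sum_(j < n | P j) W j) / r
           + r * \sum_(j < n | P j) mu j 0 ^+ 2) / 2)); last first.
    by rewrite ler_pM2r ?invr_gt0// lerD2l ler_pM2l.
  rewrite mulr_suml mulr_sumr -big_split mulr_suml; apply: ler_sum => j _ /=.
  rewrite lE normrM ger0_norm ?sqrtr_ge0// -(real_normK (num_real (mu j 0))).
  rewrite -[in leRHS](sqr_sqrtr (ltW (W_gt0 j))).
  set a := Num.sqrt _; set b := `|_|; rewrite -subr_ge0.
  rewrite (_ : _ - _ = (a - r * b) ^+ 2 / (2 * r)); last by field; rewrite gt_eqF.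
  by rewrite divr_ge0 ?sqr_ge0// mulr_ge0// ltW.
have := mu_plank (Ordinal i_n); rewrite /= => h; apply: le_trans h _.
rewrite linear_sum le_eqVlt; apply/orP; left; apply/eqP.
congr (`|_ - _|); apply: eq_bigr => j _.
by rewrite mxE [in RHS]linearZ /= lE mulrC.
Qed.

End sequence.

(** The dual norm need not be attained, hence the loss [c^-1], which is
    compensated in [sequence_plank] by the slack in the sum of the widths. *)
Lemma dual_norm1_witness (R : realType) (X : normedModType R)
    (phi : {linear X -> R^o}) (c : R) :
  dual_norm phi = 1%E -> 0 < c < 1 ->
  exists y : X, phi y = 1 :> R /\ `|y| <= c^-1.
Proof.
move=> phi1 /andP[c_gt0 c_lt1].
have : (c%:E < dual_norm phi)%E by rewrite phi1 lte_fin.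
move=> /ereal_sup_gt[_ [x x1 <-]]; rewrite lte_fin => c_lt.
have {x1} : `|x| <= 1.
  by move: x1; rewrite closed_ballE// /closed_ball_ /= sub0r normrN.
move=> x1.
have p_gt0 : 0 < `|phi x : R| by exact: lt_trans c_lt.
exists ((phi x : R)^-1 *: x); split.
  by rewrite linearZ; apply: mulVf; rewrite -normr_gt0.
rewrite normrZ normfV -[leRHS]mulr1 ler_pM//.
by rewrite lef_pV2 ?posrE// ltW.
Qed.

(** The points [x n] solving the first [n] planks converge along an ultrafilter:
    each truncation to [N] coefficients converges there, and it is uniformly
    close to [x n].  The avoidance conditions are closed, hence hold at the
    limit. *)
Lemma sequence_plank (R : realType) (X : completeNormedModType R)
    (phi : nat -> {linear X -> R^o}) (m W : nat -> R) (c : R) :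
  (forall k, continuous (phi k)) -> (forall k, dual_norm (phi k) = 1%E) ->
  (forall k, 0 < W k) -> c < 1 -> (forall n, \sum_(k < n) W k <= c) ->
  exists2 x : X, closed_ball (0 : X) 1 x &
    forall k, W k <= `|(phi k x : R) - m k|.
Proof.
move=> phic phi1 W_gt0 c_lt1 Wc.
have c_gt0 : 0 < c by apply: lt_le_trans (Wc 1%N); rewrite big_ord1.
have /choice[y yP] k : exists y : X, phi k y = 1 :> R /\ `|y| <= c^-1.
  by apply: dual_norm1_witness; rewrite ?phi1// c_gt0.
have /choice[l lP] := finite_plank m (fun k => (yP k).1) W_gt0 Wc.
pose S N n := \sum_(j < N) l n j *: y j.
pose x n := S n n.
have tail n N : (N <= n)%N ->
    `|S N n - x n| <= c^-1 * \sum_(j < n | (N <= j)%N) `|l n j|.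
  move=> Nn; rewrite /x /S [in X in _ - X](bigID (fun j : 'I_n => j < N)%N)/=.
  rewrite -(big_ord_widen n (fun j => l n j *: y j) Nn) opprD addrA subrr add0r.
  rewrite normrN mulr_sumr; apply: le_trans (ler_norm_sum _ _ _) _.
  rewrite (eq_bigl (fun j : 'I_n => N <= j)%N) => [|j]; last by rewrite -leqNgt.
  apply: ler_sum => j _; rewrite normrZ mulrC ler_wpM2r//.
  exact: (yP j).2.
have x_le1 n : `|x n| <= 1.
  have := tail n 0%N (leq0n n); rewrite {1}/S big_ord0 sub0r normrN.
  have [_ /(_ 1 (fun=> true) ltr01) h _] := lP n.
  move=> /le_trans; apply; rewrite mulrC ler_pdivrMr// mul1r.
  apply: le_trans h _; rewrite divr1 mul1r; have := Wc n; lra.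
have [G [GU Gnat]] := @ultraFilterLemma nat \oo _.
have GP : ProperFilter G := ultra_proper.
have l_cvg j : exists p : R, l n j @[n --> G] --> p.
  apply: (@ultra_bounded_cvg R nat G GU (fun n => l n j) c) => n.
  have [l0 /(_ 1 (fun=> true) ltr01) h _] := lP n.
  have [jn|/l0 ->] := ltnP j n; last by rewrite normr0 ltW.
  apply: (@le_trans _ _ (\sum_(i < n) `|l n i|)).
    by rewrite (bigD1 (Ordinal jn))//= lerDl sumr_ge0.
  by apply: le_trans h _; rewrite divr1 mul1r; have := Wc n; lra.
have S_cvg N : exists s : X, S N n @[n --> G] --> s.
  have /choice[p pP] := l_cvg.
  exists (\sum_(j < N) p j *: y j).
  apply: (cvg_big (op := +%R)) => [|j _]; first exact: add_continuous.
  by apply: cvgZr_tmp; exact: pP.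
have x_cvg : cvg (x @ G).
  apply/cauchy_cvgP/cauchy_exP => e e_gt0.
  pose r := e / 4.
  have r_gt0 : 0 < r by rewrite divr_gt0.
  (* A tail of [c * r^2], used with the parameter [r], bounds the distance from
     [x n] to its truncation by [c^-1 * (c * r + r * c) / 2 = r]. *)
  have [N WN] := tail_sum_small Wc (mulr_gt0 c_gt0 (exprn_gt0 2 r_gt0)).
  have [s sP] := S_cvg N.
  exists s; have : \forall n \near G, `|s - S N n| < e / 2.
    by apply: (@cvgr_dist_lt _ _ _ G); rewrite ?divr_gt0.
  have : \forall n \near G, (N <= n)%N by apply: Gnat; exists N.
  apply: filterS2 => n Nn sSn; rewrite -ball_normE /=.
  rewrite (_ : s - x n = (s - S N n) + (S N n - x n)); last by rewrite addrA subrK.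
  apply: le_lt_trans (ler_normD _ _) _.
  have le_r : `|S N n - x n| <= r.
    apply: le_trans (tail n N Nn) _; rewrite ler_pdivrMl//.
    have [_ h _] := lP n; apply: le_trans (h r _ r_gt0) _.
    have : (\sum_(j < n | (N <= j)%N) W j) / r <= c * r.
      by rewrite ler_pdivrMr// -mulrA -expr2; exact: WN.
    lra.
  by move: sSn le_r; rewrite /r; lra.
pose z := lim (x @ G).
exists z.
  rewrite closed_ballE// /closed_ball_ /= sub0r normrN.
  apply: (@closed_cvg _ _ G _ (fun n => `|x n|) (fun r => r <= 1) _ _ `|z|).
  - exact: closed_le.
  - exact: filterE.
  - exact: cvg_norm.
move=> k.
apply: (@closed_cvg _ _ G _ (fun n => `|(phi k (x n) : R) - m k|) (fun r => W k <= r)).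
- exact: closed_ge.
- apply: Gnat; exists k.+1 => // n /= kn.
  by have [_ _] := lP n; apply.
- apply: cvg_norm; apply: cvgB; last exact: cvg_cst.
  by apply: continuous_cvg x_cvg; exact: phic.
Qed.

(** * The covering theorem *)

Lemma sum_geometric_le (R : realFieldType) (d : R) n :
  0 <= d -> \sum_(k < n) d / 2 ^+ k.+1 <= d.
Proof.
move=> d_ge0; suff -> : \sum_(k < n) d / 2 ^+ k.+1 = d - d / 2 ^+ n.
  by rewrite lerBlDr lerDl divr_ge0// exprn_ge0.
elim: n => [|n IH]; first by rewrite big_ord0 expr0 divr1 subrr.
rewrite big_ord_recr /= {}IH exprS; have : (2 : R) ^+ n != 0 by rewrite expf_neq0.
by set a := 2 ^+ n => a0; field.
Qed.

Lemma sum_seq_le_esum (R : realType) (I : choiceType) (D : set I) (w : I -> R)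
    (s : seq I) :
  uniq s -> {in s, forall i, D i} ->
  ((\sum_(i <- s) w i)%:E <= \esum_(i in D) (w i)%:E)%E.
Proof.
move=> s_uniq sD; apply: esum_ge; exists [set` s].
  by split; [exact: finite_seq|move=> i /sD].
by rewrite -sumEFin (fsbig_seq _ _ s_uniq).
Qed.

Theorem theorem1 (R : realType) (X : completeNormedModType R)
    (I : choiceType) (D : set I) (A : I -> set X) (w : I -> R)
    (countableD : countable D)
    (plankA : forall i : I, D i -> is_plank (A i) (w i))
    (cover : closed_ball (0 : X) 1 `<=` \bigcup_(i in D) A i) :
  (1%:E <= \esum_(i in D) (w i)%:E)%E.
Proof.
rewrite leNgt; apply/negP => sum_lt1.
have w_gt0 i : D i -> 0 < w i by move=> /plankA[].
have sum_ge0 : (0 <= \esum_(i in D) (w i)%:E)%E.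
  by apply: esum_ge0 => i Di; rewrite lee_fin ltW// w_gt0.
have [i0 Di0] : exists i, D i.
  have : closed_ball (0 : X) 1 0 by exact: closed_ballxx.
  by move=> /cover[i Di _]; exists i.
have [f f_inj] := elimT (countable_injP D) countableD.
(* Number the planks by [nat]; an index [k] not used by [f] repeats
   some plank, and is recognized by [f (g k) != k]. *)
have /choice[g gP] k :
    exists i, D i /\ ((exists2 j, D j & f j = k) -> f i = k).
  have [[j Dj fj]|nk] := pselect (exists2 j, D j & f j = k).
    by exists j; split.
  by exists i0; split.
have Dg k : D (g k) by have [] := gP k.
have gf i : D i -> g (f i) = i.
  move=> Di; apply: f_inj; [exact/mem_set/Dg|exact: mem_set|].
  by have [_] := gP (f i); apply; exists i.
have /choice[pm pmP] k : exists pm : {linear X -> R^o} * R,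
    [/\ continuous pm.1, dual_norm pm.1 = 1%E &
        A (g k) = [set x : X | `|(pm.1 x : R) - pm.2| <= w (g k)]].
  by have [_ [phi [m h]]] := plankA _ (Dg k); exists (phi, m).
have [S S_E] : exists S : R, (\esum_(i in D) (w i)%:E)%E = S%:E.
  exists (fine (\esum_(i in D) (w i)%:E)); rewrite fineK//.
  by rewrite ge0_fin_numE// (lt_trans sum_lt1)// ltry.
rewrite S_E lte_fin in sum_lt1.
pose d := (1 - S) / 2.
have d_gt0 : 0 < d by rewrite divr_gt0// subr_gt0.
(* The geometric term widens every plank, so that avoiding the closed inequality
   gives strict avoidance, and gives the repeated planks a positive width at
   total cost at most [d]. *)
pose W k := (if f (g k) == k then w (g k) else 0) + d / 2 ^+ k.+1.
have r_gt0 k : 0 < d / 2 ^+ k.+1 by rewrite divr_gt0// exprn_gt0.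
have W_gt0 k : 0 < W k.
  by rewrite ltr_wpDl//; case: ifP => // _; rewrite ltW// w_gt0.
have W_sum n : \sum_(k < n) W k <= S + d.
  rewrite big_split lerD ?sum_geometric_le ?(ltW d_gt0)//=.
  rewrite -big_mkcond -(big_mkord (fun k => f (g k) == k) (fun k => w (g k))).
  rewrite -big_filter -(big_map g xpredT w) -lee_fin -S_E.
  apply: sum_seq_le_esum => [|i /mapP[k _ ->]]; last exact: Dg.
  rewrite map_inj_in_uniq ?filter_uniq ?iota_uniq// => j k.
  rewrite !mem_filter => /andP[/eqP + _] /andP[/eqP + _] gjk.
  by rewrite gjk => -> .
have c_lt1 : S + d < 1 by rewrite /d; lra.
have [x x1 xW] := @sequence_plank R X (fun k => (pm k).1) (fun k => (pm k).2) W (S + d)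
  (fun k => let: And3 h _ _ := pmP k in h) (fun k => let: And3 _ h _ := pmP k in h)
  W_gt0 c_lt1 W_sum.
have [i Di] := cover x x1.
have [_ _] := pmP (f i); rewrite gf// => -> /= xi.
have := le_trans (xW (f i)) xi.
by rewrite /W gf// eqxx leNgt ltrDl r_gt0.
Qed.
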